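(* Let $\tilde w^k\in\Omega$ be a predictor for $\xi^k\in\Xi$ with matrix $\mathcal Q\in\mathbb R^{3m\times 3m}$ (with $\mathcal Q^T+\mathcal Q$ positive definite), i.e. $$\theta(u)-\theta(\tilde u^k)+(w-\tilde w^k)^TF(\tilde w^k)\ \ge\ (\xi-\tilde\xi^k)^T\mathcal Q(\xi^k-\tilde\xi^k)\qquad\forall\, w\in\Omega\ (\xi=Pw),$$ where $\tilde\xi^k=P\tilde w^k$, and let $\xi^{k+1}=\xi^k-\mathcal M(\xi^k-\tilde\xi^k)$ with $\mathcal M\in\mathbb R^{3m\times3m}$ non-singular. If there is a positive definite matrix $\mathcal H\in\mathbb R^{3m\times 3m}$ such that $$\mathcal H\mathcal M=\mathcal Q\qquad\text{and}\qquad \mathcal G:=\mathcal Q^T+\mathcal Q-\mathcal M^T\mathcal H\mathcal M\succ0,$$ then $$\|\xi^{k+1}-\xi^*\|_{\mathcal H}^2\le\|\xi^k-\xi^*\|_{\mathcal H}^2-\|\xi^k-\tilde\xi^k\|_{\mathcal G}^2\qquad\forall\,\xi^*\in\Xi^*.$$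
   Context: Problem: $\min\{\theta_1(x)+\theta_2(y)\mid Ax+By=b\ (\text{or }\ge b),\ x\in\mathcal X,\ y\in\mathcal Y\}$, where $\theta_i:\mathbb R^{n_i}\to\mathbb R$ ($i=1,2$) are closed proper convex functions (not necessarily smooth), $\mathcal X\subseteq\mathbb R^{n_1}$, $\mathcal Y\subseteq\mathbb R^{n_2}$ are closed convex sets, $A\in\mathbb R^{m\times n_1}$, $B\in\mathbb R^{m\times n_2}$, $b\in\mathbb R^m$. Put $\Lambda=\mathbb R^m$ in the equality case and $\Lambda=\mathbb R^m_+$ in the inequality case, and $\Omega=\mathcal X\times\mathcal Y\times\Lambda$. Write $w=(x,y,\lambda)$, $u=(x,y)$, $\theta(u)=\theta_1(x)+\theta_2(y)$ and $$F(w)=\begin{pmatrix} -A^T\lambda \\ -B^T\lambda \\ A x+By-b \end{pmatrix}.$$ $\Omega^*$ is the set of all $w^*\in\Omega$ with $\theta(u)-\theta(u^* )+(w-w^* )^TF(w^* )\ge0$ for all $w\in\Omega$. Tildes and superscripts carry over to components: $\tilde w^k=(\tilde x^k,\tilde y^k,\tilde\lambda^k)$, $\tilde u^k=(\tilde x^k,\tilde y^k)$. For a fixed $\beta>0$, $P=\mathrm{diag}(\sqrt\beta A,\sqrt\beta B,\tfrac1{\sqrt\beta}I_m)$ (block diagonal), $\xi=Pw\in\mathbb R^{3m}$, $\Xi=\{Pw\mid w\in\Omega\}$, $\Xi^*=\{Pw^*\mid w^*\in\Omega^*\}$. Positive definite (written $\succ0$) means symmetric positive definite, and $\|v\|_{\mathcal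 H}^2=v^T\mathcal Hv$. *)

(* Defs.v *)
From HB Require Import structures.
From mathcomp Require Import all_boot all_order all_algebra.
From mathcomp Require Import boolp classical_sets reals ereal.
From mathcomp Require Import topology normedtype convex.

Set Implicit Arguments.
Unset Strict Implicit.
Unset Printing Implicit Defensive.

Import Order.TTheory GRing.Theory Num.Theory numFieldNormedType.Exports.

Local Open Scope classical_set_scope.
Local Open Scope ring_scope.

Section quadratic_forms.
Variables (R : realType) (n : nat).

Definition dotv (u v : 'cV[R]_n) : R := (u^T *m v) 0 0.

Definition sqnorm (H : 'M[R]_n) (v : 'cV[R]_n) : R := (v^T *m H *m v) 0 0.

Definition posdef (H : 'M[R]_n) : Prop :=
  H^T = H /\ forall v : 'cV[R]_n, v != 0 -> 0 < sqnorm H v.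

End quadratic_forms.

(* Properness (nowhere -oo, somewhere finite) is built into the codomain R;
   for a proper convex function, closedness is lower semicontinuity. *)
Definition closed_proper_convex (R : realType) (n : nat) (f : 'cV[R]_n -> R)
    : Prop :=
  convex_function [set: 'cV[R]_n] f /\
  lower_semicontinuous (fun x : 'cV[R]_n => (f x)%:E).

(* The linking constraint: A x + B y = b, or A x + B y >= b. *)
Inductive constraint_kind := EqConstraint | GeConstraint.

Section separable_problem.
Variables (R : realType) (n1 n2 m : nat).

(* w = (x, y, lambda), stacked as a column. *)
Local Notation wvec := 'cV[R]_(n1 + n2 + m).

Definition xpart (w : wvec) : 'cV[R]_n1 := usubmx (usubmx w).
Definition ypart (w : wvec) : 'cV[R]_n2 := dsubmx (usubmx w).
Definition lpart (w : wvec) : 'cV[R]_m := dsubmx w.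
Definition upart (w : wvec) : 'cV[R]_(n1 + n2) := usubmx w.

Definition multipliers (c : constraint_kind) : set 'cV[R]_m :=
  match c with
  | EqConstraint => setT
  | GeConstraint => [set l | forall i, 0 <= l i 0]
  end.

Definition Omega (c : constraint_kind) (X : set 'cV[R]_n1)
    (Y : set 'cV[R]_n2) : set wvec :=
  [set w | [/\ X (xpart w), Y (ypart w) & multipliers c (lpart w)]].

Definition theta (theta1 : 'cV[R]_n1 -> R) (theta2 : 'cV[R]_n2 -> R)
    (u : 'cV[R]_(n1 + n2)) : R :=
  theta1 (usubmx u) + theta2 (dsubmx u).

Definition F (A : 'M[R]_(m, n1)) (B : 'M[R]_(m, n2)) (b : 'cV[R]_m)
    (w : wvec) : wvec :=
  col_mx (col_mx (- (A^T *m lpart w)) (- (B^T *m lpart w)))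
         (A *m xpart w + B *m ypart w - b).

Definition OmegaStar (c : constraint_kind) (X : set 'cV[R]_n1)
    (Y : set 'cV[R]_n2) (theta1 : 'cV[R]_n1 -> R) (theta2 : 'cV[R]_n2 -> R)
    (A : 'M[R]_(m, n1)) (B : 'M[R]_(m, n2)) (b : 'cV[R]_m) : set wvec :=
  [set ws | Omega c X Y ws /\
    forall w, Omega c X Y w ->
      theta theta1 theta2 (upart w) - theta theta1 theta2 (upart ws)
      + dotv (w - ws) (F A B b ws) >= 0].

Definition P (beta : R) (A : 'M[R]_(m, n1)) (B : 'M[R]_(m, n2))
    : 'M[R]_(m + m + m, n1 + n2 + m) :=
  block_mx (block_mx (Num.sqrt beta *: A) 0 0 (Num.sqrt beta *: B)) 0
           0 ((Num.sqrt beta)^-1 *: 1%:M).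

Definition Xi (beta : R) (c : constraint_kind) (X : set 'cV[R]_n1)
    (Y : set 'cV[R]_n2) (A : 'M[R]_(m, n1)) (B : 'M[R]_(m, n2))
    : set 'cV[R]_(m + m + m) :=
  [set P beta A B *m w | w in Omega c X Y].

Definition XiStar (beta : R) (c : constraint_kind) (X : set 'cV[R]_n1)
    (Y : set 'cV[R]_n2) (theta1 : 'cV[R]_n1 -> R) (theta2 : 'cV[R]_n2 -> R)
    (A : 'M[R]_(m, n1)) (B : 'M[R]_(m, n2)) (b : 'cV[R]_m)
    : set 'cV[R]_(m + m + m) :=
  [set P beta A B *m ws | ws in OmegaStar c X Y theta1 theta2 A B b].

Definition predictor (beta : R) (c : constraint_kind) (X : set 'cV[R]_n1)
    (Y : set 'cV[R]_n2) (theta1 : 'cV[R]_n1 -> R) (theta2 : 'cV[R]_n2 -> R)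
    (A : 'M[R]_(m, n1)) (B : 'M[R]_(m, n2)) (b : 'cV[R]_m)
    (Q : 'M[R]_(m + m + m)) (xik : 'cV[R]_(m + m + m)) (wt : wvec) : Prop :=
  Omega c X Y wt /\
  forall w, Omega c X Y w ->
    theta theta1 theta2 (upart w) - theta theta1 theta2 (upart wt)
    + dotv (w - wt) (F A B b wt)
    >= dotv (P beta A B *m w - P beta A B *m wt)
            (Q *m (xik - P beta A B *m wt)).

End separable_problem.

(* Main.v *)
(* The operator F is affine with a skew-symmetric linear part, so adding the
   predictor inequality at w* to the optimality inequality of w* at the
   predictor cancels theta and F and leaves (xi~ - xi* )^T Q (xi - xi~) >= 0.
   Since H M = Q, this is exactly what bounds the cross term when the square
   |xi - xi* - M (xi - xi~)|_H^2 is expanded. *)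

Require Import Defs.
From HB Require Import structures.
From mathcomp Require Import all_boot all_order all_algebra.
From mathcomp Require Import boolp classical_sets reals ereal.
From mathcomp Require Import topology normedtype convex.
From mathcomp Require Import ring lra.

Set Implicit Arguments.
Unset Strict Implicit.
Unset Printing Implicit Defensive.

Import Order.TTheory GRing.Theory Num.Theory numFieldNormedType.Exports.

Local Open Scope classical_set_scope.
Local Open Scope ring_scope.

Section dot_product.
Variable R : realType.

Lemma dotvC n (u v : 'cV[R]_n) : dotv u v = dotv v u.
Proof. by rewrite /dotv -[v in LHS]trmxK -trmx_mul mxE. Qed.

Lemma dotvDl n (u v w : 'cV[R]_n) : dotv (u + v) w = dotv u w + dotv v w.
Proof. by rewrite /dotv linearD mulmxDl mxE. Qed.

Lemma dotvNl n (u v : 'cV[R]_n) : dotv (- u) v = - dotv u v.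
Proof. by rewrite /dotv linearN mulNmx mxE. Qed.

Lemma dotvDr n (u v w : 'cV[R]_n) : dotv u (v + w) = dotv u v + dotv u w.
Proof. by rewrite dotvC dotvDl !(dotvC u). Qed.

Lemma dotvNr n (u v : 'cV[R]_n) : dotv u (- v) = - dotv u v.
Proof. by rewrite dotvC dotvNl dotvC. Qed.

Definition dotvE := (dotvDl, dotvNl, dotvDr, dotvNr).

Lemma dotv_mulmxr m n (A : 'M[R]_(m, n)) u v :
  dotv u (A *m v) = dotv (A^T *m u) v.
Proof. by rewrite /dotv trmx_mul trmxK mulmxA. Qed.

Lemma dotv_col_mx m n (u u' : 'cV[R]_m) (v v' : 'cV[R]_n) :
  dotv (col_mx u v) (col_mx u' v') = dotv u u' + dotv v v'.
Proof. by rewrite /dotv tr_col_mx mul_row_col mxE. Qed.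

Lemma sqnormE n (H : 'M[R]_n) v : sqnorm H v = dotv v (H *m v).
Proof. by rewrite /sqnorm /dotv mulmxA. Qed.

End dot_product.

Section correction_step.
Variables (R : realType) (n : nat).
Implicit Types H M Q : 'M[R]_n.

(** Symmetry of [H] is what merges the two cross terms into one. *)
Lemma sqnormB H u v : H^T = H ->
  sqnorm H (u - v) = sqnorm H u - 2 * dotv u (H *m v) + sqnorm H v.
Proof.
move=> symH; rewrite !sqnormE mulmxBr !dotvE.
rewrite (dotv_mulmxr H v u) symH (dotvC (H *m v)); ring.
Qed.

(** With [H *m M = Q] the cross term of the expanded square is [dotv e (Q *m d)]. Splitting
    [e = (e - d) + d] leaves [2 * dotv d (Q *m d) - sqnorm H (M *m d)], which is the quadratic form
    of the matrix G, plus a remainder whose sign the variational inequalities control. *)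
Lemma sqnorm_step H M Q e d : H^T = H -> H *m M = Q ->
  sqnorm H (e - M *m d) =
  sqnorm H e - sqnorm (Q^T + Q - M^T *m H *m M) d
  - 2 * dotv (e - d) (Q *m d).
Proof.
move=> symH HMQ; rewrite sqnormB // mulmxA HMQ.
have -> : sqnorm (Q^T + Q - M^T *m H *m M) d =
          2 * dotv d (Q *m d) - sqnorm H (M *m d).
  rewrite !sqnormE !mulmxDl mulNmx -!mulmxA !dotvE.
  (* [Q^T] and [Q] define the same quadratic form, hence the factor 2. *)
  by rewrite !dotv_mulmxr !trmxK (dotvC (Q *m d)) (dotv_mulmxr Q); ring.
rewrite dotvDl dotvNl; ring.
Qed.

End correction_step.

(** In the difference of the two values of [F] the constant [b] drops out, and what remains is a
    skew-symmetric matrix applied to [w - w'], orthogonal to [w - w'] itself. *)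
Lemma dotv_subF (R : realType) (n1 n2 m : nat) (A : 'M[R]_(m, n1))
    (B : 'M[R]_(m, n2)) (b : 'cV[R]_m) (w w' : 'cV[R]_(n1 + n2 + m)) :
  dotv (w - w') (F A B b w) = dotv (w - w') (F A B b w').
Proof.
apply/eqP; rewrite -subr_eq0 -dotvNr -dotvDr; apply/eqP.
set d := w - w'.
have -> : F A B b w - F A B b w' =
    col_mx (col_mx (- (A^T *m lpart d)) (- (B^T *m lpart d)))
           (A *m xpart d + B *m ypart d).
  rewrite /F /d /lpart /xpart /ypart !linearB /= !opp_col_mx !add_col_mx.
  congr (col_mx (col_mx _ _) _).
  by rewrite opprB addrA subrK opprD addrACA.
rewrite -{1}(vsubmxK d) -(vsubmxK (usubmx d)) !dotv_col_mx.
rewrite -/(xpart d) -/(ypart d) -/(lpart d) !dotvE.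
(* Moving matrices to the left turns the [A^T] terms into [A] terms and conversely; swapping the
   former and moving once more gives all four products one form, so they cancel in pairs. *)
rewrite !dotv_mulmxr !trmxK [dotv (A *m _) _]dotvC [dotv (B *m _) _]dotvC.
rewrite !dotv_mulmxr; ring.
Qed.

Theorem theorem3p1 (R : realType) (n1 n2 m : nat) (c : constraint_kind)
    (theta1 : 'cV[R]_n1 -> R) (theta2 : 'cV[R]_n2 -> R)
    (X : set 'cV[R]_n1) (Y : set 'cV[R]_n2)
    (A : 'M[R]_(m, n1)) (B : 'M[R]_(m, n2)) (b : 'cV[R]_m) (beta : R)
    (Q M H : 'M[R]_(m + m + m))
    (xik xik1 : 'cV[R]_(m + m + m)) (wt : 'cV[R]_(n1 + n2 + m))
    (htheta1 : closed_proper_convex theta1)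
    (htheta2 : closed_proper_convex theta2)
    (closedX : closed X) (convexX : convex_set X)
    (closedY : closed Y) (convexY : convex_set Y)
    (beta_gt0 : 0 < beta)
    (hxik : Xi beta c X Y A B xik)
    (hQ : posdef (Q^T + Q))
    (hpred : predictor beta c X Y theta1 theta2 A B b Q xik wt)
    (hM : M \in unitmx)
    (hxik1 : xik1 = xik - M *m (xik - P beta A B *m wt))
    (hH : posdef H) (hHM : H *m M = Q)
    (hG : posdef (Q^T + Q - M^T *m H *m M)) :
  forall xis : 'cV[R]_(m + m + m),
    XiStar beta c X Y theta1 theta2 A B b xis ->
    sqnorm H (xik1 - xis)
    <= sqnorm H (xik - xis)
       - sqnorm (Q^T + Q - M^T *m H *m M) (xik - P beta A B *m wt).
Proof.
move=> _ [ws [ws_in ws_opt] <-].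
have [wt_in wt_pred] := hpred.
have := wt_pred _ ws_in; have := ws_opt _ wt_in.
(* Both inequalities now take [F] at the same point, with opposite signs. *)
rewrite -dotv_subF -(opprB ws wt) dotvNl.
set xt := P beta A B *m wt in hxik1 *; set xs := P beta A B *m ws.
set d := xik - xt in hxik1 *; rewrite -(opprB xt xs) dotvNl => opt pred.
have [symH _] := hH.
have -> : xik1 - xs = (xik - xs) - M *m d by rewrite hxik1 addrAC.
rewrite (sqnorm_step _ _ symH hHM).
(* The remainder becomes [dotv (xt - xs) (Q *m d)], nonnegative by the sum of [opt] and [pred]. *)
have -> : xik - xs - d = xt - xs by rewrite /d opprB addrC addrA subrK.
by lra.
Qed.
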